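(* Let $(X,d)$ be a complete metric space and let $A,B\subseteq X$ be nonempty closed subsets such that $A_0$ is nonempty. Let $T:A\to B$ be a weakly contractive mapping, that is, there exists a continuous and nondecreasing function $\phi:[0,\infty)\to[0,\infty)$ such that $\phi$ is positive on $(0,\infty)$, $\phi(0)=0$, $\lim_{t\to\infty}\phi(t)=\infty$, and $$d(Tx,Ty)\leq d(x,y)-\phi(d(x,y))\quad\text{for all } x,y\in A.$$ Assume that the pair $(A,B)$ has the P-property and that $T(A_0)\subseteq B_0$. Then $T$ has a unique best proximity point, i.e. there exists a unique $x^*\in A$ such that $d(x^*,Tx^* )=dist(A,B)$.
   Context: For nonempty subsets $A,B$ of a metric space $(X,d)$: - $dist(A,B):=\inf\{d(x,y) : (x,y)\in A\times B\}$. - $A_0:=\{x\in A : d(x,y)=dist(A,B)\text{ for some } y\in B\}$. - $B_0:=\{y\in B : d(x,y)=dist(A,B)\text{ for some } x\in A\}$. - A point $x^*\in A$ is a best proximity point of a mapping $T:A\to B$ if $d(x^*,Tx^* )=dist(A,B)$. - When $A_0\neq\emptyset$, the pair $(A,B)$ has the P-property if for all $x_1,x_2\in A_0$ and $y_1,y_2\in B_0$, the equalities $d(x_1,y_1)=dist(A,B)$ and $d(x_2,y_2)=dist(A,B)$ together imply $d(x_1,x_2)=d(y_1,y_2)$. *)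

(* Defs.v *)
From HB Require Import structures.
From mathcomp Require Import all_boot all_order all_algebra.
From mathcomp Require Import all_classical all_reals all_analysis.

Set Implicit Arguments.
Unset Strict Implicit.
Unset Printing Implicit Defensive.

Import Order.TTheory GRing.Theory Num.Theory.
Import numFieldNormedType.Exports.

Local Open Scope classical_set_scope.
Local Open Scope ring_scope.

(* [Complete] brings along [isPointed]: the carrier is inhabited, which costs
   nothing for a space that has a nonempty subset. *)
#[short(type="completeMetricType")]
HB.structure Definition CompleteMetric (R : numDomainType) :=
  {M of Metric R M & Complete M}.

Section best_proximity.
Context {R : realType} {X : metricType R}.
Implicit Types (A B : set X) (T : X -> X) (x y : X).

(* For nonempty [A] and [B] the set of distances is nonempty and bounded below
   by 0, so the total operator [inf] is the genuine infimum. *)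
Definition set_dist A B : R := inf [set mdist p.1 p.2 | p in A `*` B].

Definition prox_l A B : set X :=
  [set x | A x /\ exists2 y, B y & mdist x y = set_dist A B].

Definition prox_r A B : set X :=
  [set y | B y /\ exists2 x, A x & mdist x y = set_dist A B].

Definition best_proximity_point A B T x : Prop :=
  A x /\ mdist x (T x) = set_dist A B.

Definition P_property A B : Prop :=
  forall x1 x2 y1 y2,
    prox_l A B x1 -> prox_l A B x2 -> prox_r A B y1 -> prox_r A B y2 ->
    mdist x1 y1 = set_dist A B -> mdist x2 y2 = set_dist A B ->
    mdist x1 x2 = mdist y1 y2.

(* Only the values of [phi] on [0, +oo[ and those of [T] on [A] matter. *)
Definition weakly_contractive A T : Prop :=
  exists phi : {fun (`[0, +oo[ : set R) >-> (`[0, +oo[ : set R)},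
    [/\ {within `[0, +oo[, continuous phi},
        {in `[0, +oo[ &, nondecreasing_fun phi},
        forall t : R, 0 < t -> 0 < phi t,
        phi 0 = 0 &
        phi t @[t --> +oo] --> +oo] /\
    forall x y, A x -> A y ->
      mdist (T x) (T y) <= mdist x y - phi (mdist x y).

End best_proximity.

(* Main.v *)
Require Import Defs.
From HB Require Import structures.
From mathcomp Require Import all_boot all_order all_algebra.
From mathcomp Require Import all_classical all_reals all_analysis.
From mathcomp Require Import lra.

Set Implicit Arguments.
Unset Strict Implicit.
Unset Printing Implicit Defensive.

Import Order.TTheory GRing.Theory Num.Theory.
Import numFieldNormedType.Exports.

Local Open Scope classical_set_scope.
Local Open Scope ring_scope.

(** Since [T] maps [A_0] into [B_0], one can choose [x_(n+1)] in [A_0] with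
    [d (x_(n+1), T x_n) = dist (A, B)], starting from any [x_0] in [A_0]. The
    P-property gives [d (x_(m+1), x_(n+1)) = d (T x_m, T x_n)], so the sequence
    behaves like an orbit of a weakly contractive self-map: it is Cauchy, and its
    limit is a best proximity point. The P-property also turns two best proximity
    points [x, y] into [d (x, y) = d (T x, T y)], which forces [x = y]. *)

Lemma set_dist_le (R : realType) (X : metricType R) (A B : set X) (x y : X) :
  A x -> B y -> set_dist A B <= mdist x y.
Proof.
move=> Ax By; apply: ge_inf; last by exists (x, y).
by exists 0 => _ [p _ <-]; exact: mdist_ge0.
Qed.

Section weakly_contractive_sequence.
Context {R : realType} {X : metricType R}.
Variables (phi : R -> R) (u : nat -> X).
Hypothesis phi_homo : forall s t, 0 <= s -> s <= t -> phi s <= phi t.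
Hypothesis phi0 : phi 0 = 0.
Hypothesis phi_gt0 : forall t, 0 < t -> 0 < phi t.
Hypothesis u_contr : forall m n,
  mdist (u m.+1) (u n.+1) <= mdist (u m) (u n) - phi (mdist (u m) (u n)).

(** If no step were shorter than [e], monotonicity of [phi] would make each step shorter than the
    previous one by at least [phi e], and step lengths would eventually be negative. *)
Lemma small_step (e : R) : 0 < e -> exists n, mdist (u n) (u n.+1) < e.
Proof.
move=> e0; apply: contrapT => /forallNP small.
have large n : e <= mdist (u n) (u n.+1) by rewrite leNgt; exact/negP.
have decr n : mdist (u n) (u n.+1) <= mdist (u 0) (u 1) - phi e *+ n.
  elim: n => [|n IHn]; first by rewrite mulr0n subr0.
  have := u_contr n n.+1; have := phi_homo (ltW e0) (large n).
  by rewrite mulrSr; lra.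
pose n := Num.bound (mdist (u 0) (u 1) / phi e).
have : mdist (u 0) (u 1) / phi e < n%:R.
  by apply: archi_boundP; rewrite divr_ge0 ?mdist_ge0// ltW// phi_gt0.
rewrite ltr_pdivrMr ?phi_gt0// mulr_natl.
by have := decr n; have := large n; lra.
Qed.

(* If the step at time [n] is shorter than [e/4] and [phi (e/4)], the closed ball
   of radius [e/2] around [u n] traps the rest of the sequence: a point within
   [e/4] of [u n] cannot leave in one step, a farther one is pulled back by at
   least [phi (e/4)]. *)
Lemma weakly_contractive_cauchy : cauchy (u @ \oo).
Proof.
apply: cauchy_exP => e e0.
have e4 : 0 < e / 2 / 2 by rewrite !divr_gt0.
have [n] : exists n,
    mdist (u n) (u n.+1) < Num.min (e / 2 / 2) (phi (e / 2 / 2)).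
  by apply: small_step; rewrite lt_min e4 phi_gt0.
rewrite lt_min => /andP[step_e step_phi].
have trap k : mdist (u n) (u (n + k)%N) <= e / 2.
  elim: k => [|k IHk]; first by rewrite addn0 mdistxx; lra.
  rewrite addnS.
  have tri := metric_triangle (u n) (u n.+1) (u (n + k).+1).
  have ctr := u_contr n (n + k)%N.
  have d0 := mdist_ge0 (u n) (u (n + k)%N).
  have [far|near_n] := leP (e / 2 / 2) (mdist (u n) (u (n + k)%N)).
    by have := phi_homo (ltW e4) far; lra.
  suff : 0 <= phi (mdist (u n) (u (n + k)%N)) by lra.
  by rewrite -phi0 phi_homo.
exists (u n), n => // m /= /subnKC <-; rewrite ballEmdist/=.
by have := trap (m - n)%N; lra.
Qed.

End weakly_contractive_sequence.

Theorem theorem2p3 (R : realType) (X : completeMetricType R) (A B : set X)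
    (T : {fun A >-> B}) :
  A !=set0 -> B !=set0 -> closed A -> closed B ->
  prox_l A B !=set0 ->
  weakly_contractive A T ->
  P_property A B ->
  T @` prox_l A B `<=` prox_r A B ->
  exists! x : X, best_proximity_point A B T x.
Proof.
move=> _ _ clA _ [x0 x0A0] [phi [[_ phi_homo phi_gt0 phi0 _] T_contr]] PAB TA0.
have phiW s t : 0 <= s -> s <= t -> phi s <= phi t.
  move=> s0 st; apply: (phi_homo _ _ _ _ st); rewrite in_itv/= andbT//.
  exact: le_trans st.
have T_le x y : A x -> A y -> mdist (T x) (T y) <= mdist x y.
  move=> Ax Ay; have := T_contr _ _ Ax Ay.
  by have := phiW _ _ (lexx 0) (mdist_ge0 x y); rewrite phi0; lra.
(* The guard inside the existential makes [g] total; outside [A_0] the value [x] is a dummy. *)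
have /choice[g gP] x : exists y, prox_l A B x ->
    prox_l A B y /\ mdist y (T x) = set_dist A B.
  have [xA0|] := pselect (prox_l A B x); last by exists x.
  have [BTx [y Ay yTx]] := TA0 _ (imageP T xA0).
  by exists y => _; split => //; split => //; exists (T x).
pose u n := iter n g x0.
have uA0 n : prox_l A B (u n) by elim: n => //= n /gP[].
have uA n : A (u n) by case: (uA0 n).
have uT n : mdist (u n.+1) (T (u n)) = set_dist A B by have [] := gP _ (uA0 n).
have TuB0 n : prox_r A B (T (u n)) by apply: TA0; exists (u n).
have u_contr m n :
    mdist (u m.+1) (u n.+1) <= mdist (u m) (u n) - phi (mdist (u m) (u n)).
  by rewrite (PAB _ _ (T (u m)) (T (u n))) ?uT//; exact: T_contr.
have /cauchy_cvgP/cvg_ex[x ux] := weakly_contractive_cauchy phiW phi0 phi_gt0 u_contr.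
have Ax : A x by apply: (closed_cvg _ clA _ _ ux); exact: nearW.
have xTx : best_proximity_point A B T x.
  split=> //; apply/eqP; rewrite eq_le set_dist_le ?andbT//; last exact: funS.
  (* Go from [x] to [T x] through [u n.+1] and [T (u n)]: the middle leg is exactly [set_dist A B].
     The outer legs are below [e / 2] once [u n] and [u n.+1] are both near [x], the last one
     because [T] is nonexpansive. *)
  apply/ler_addgt0Pr => e e0.
  have e2 : 0 < e / 2 by rewrite divr_gt0.
  have [n _ near_x] := ux _ (nbhsx_ballx x _ e2).
  have := near_x n (leqnn n); have := near_x n.+1 (leqnSn n).
  rewrite /= !ballEmdist/= => xuS xu.
  have := T_le _ _ (uA n) Ax; rewrite (metric_sym (u n)).
  have := metric_triangle x (u n.+1) (T x).
  by have := metric_triangle (u n.+1) (T (u n)) (T x); rewrite uT; lra.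
(* These memberships let the P-property apply to any two best proximity points. *)
have best_prox z : best_proximity_point A B T z ->
    prox_l A B z /\ prox_r A B (T z).
  move=> [Az zT]; suff zA0 : prox_l A B z by split=> //; apply: TA0; exists z.
  by split=> //; exists (T z) => //; exact: funS.
exists x; split=> // y yTy; apply: contrapT => /eqP; rewrite -mdist_gt0 => xy.
have [xA0 TxB0] := best_prox _ xTx; have [yA0 TyB0] := best_prox _ yTy.
have := T_contr _ _ Ax yTy.1; have := phi_gt0 _ xy.
by rewrite -(PAB _ _ _ _ xA0 yA0 TxB0 TyB0 xTx.2 yTy.2); lra.
Qed.
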